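(* Let $n\ge1$ and $D\ge 0$ be integers and let $L\le\mathbb{Z}^n$ be a full-rank sublattice with $d_{\mathrm a}(L)>D$. Then $((D+1)\Delta_n,L)$ is a lattice packing in $\mathbb{R}^n$, i.e. the translates $(D+1)\Delta_n+\ell$, $\ell\in L$, have pairwise disjoint interiors. Consequently, if $L\le\mathbb{Z}^n$ is a full-rank sublattice such that $S_{n,D}+L$ is a lattice tiling of $\mathbb{Z}^n$, then $$\frac{(D+1)^n}{n!\,|S_{n,D}|}\le\delta_{\mathrm L}(\Delta_n).$$
   Context: For $u\in\mathbb{R}$ put $u^+=\max\{u,0\}$. The asymmetric Manhattan metric on $\mathbb{Z}^n$ is $d_{\mathrm a}(x,y)=\max\{\sum_{i=1}^n(x_i-y_i)^+,\ \sum_{i=1}^n(y_i-x_i)^+\}$. For a full-rank sublattice $L\le\mathbb{Z}^n$, $d_{\mathrm a}(L)=\min\{d_{\mathrm a}(0,\ell):0\ne\ell\in L\}$. The standard simplex is $\Delta_n=\operatorname{conv}\{0,e^{(1)},\dots,e^{(n)}\}\subset\mathbb{R}^n$, where $e^{(i)}$ are the standard basis vectors, and $\delta_{\mathrm L}(\Delta_n)$ denotes its lattice-packing density, i.e. the supremum of $\operatorname{vol}(\Delta_n)/\det\Lambda$ over full-rank lattices $\Lambda\subset\mathbb{R}^n$ such that the translates $\Delta_n+\lambda$, $\lambda\in\Lambda$, have pairwise disjoint interiors. For nonnegative integers $P,Q$, $S_n(P,Q)=\{x\in\mathbb{Z}^n:\sum_{i}x_i^+\le P,\ \sum_{i}(-x_i)^+\le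 Q\}$, and $S_{n,D}=S_n(\lceil D/2\rceil,\lfloor D/2\rfloor)$. $S_{n,D}+L$ is a lattice tiling of $\mathbb{Z}^n$ if the translates $S_{n,D}+\ell$, $\ell\in L$, are pairwise disjoint and cover $\mathbb{Z}^n$. *)

(* Defs.v *)
From HB Require Import structures.
From mathcomp Require Import all_boot all_order all_algebra finmap.
From mathcomp Require Import all_classical all_reals all_analysis.

Set Implicit Arguments.
Unset Strict Implicit.
Unset Printing Implicit Defensive.

Import Order.TTheory GRing.Theory Num.Theory.
Import numFieldNormedType.Exports.

Local Open Scope classical_set_scope.
Local Open Scope ring_scope.

Definition translate (V : zmodType) (K : set V) (l : V) : set V :=
  [set x + l | x in K].

Definition pos_part (u : int) : int := Num.max u 0.

Definition da (n : nat) (x y : 'rV[int]_n) : int :=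
  Num.max (\sum_i pos_part (x 0 i - y 0 i)) (\sum_i pos_part (y 0 i - x 0 i)).

Definition full_rank_sublattice (n : nat) (L : set 'rV[int]_n) : Prop :=
  zmod_closed [in L] /\
  exists2 B : 'M[int]_n, row_free (map_mx intr B : 'M[rat]_n) &
    forall i, L (row i B).

Definition is_min (A : set int) (m : int) : Prop := A m /\ lbound A m.

(* The minimum exists as soon as L has a nonzero element, which is the case for
   full-rank L and n >= 1; otherwise the value is the default 0. *)
Definition da_lattice (n : nat) (L : set 'rV[int]_n) : int :=
  xget 0 (is_min [set da 0 l | l in L `\ 0]).

Definition anticode (n P Q : nat) : set 'rV[int]_n :=
  [set x | \sum_i pos_part (x 0 i) <= P%:Z /\
           \sum_i pos_part (- x 0 i) <= Q%:Z].

Arguments anticode : clear implicits.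

(* [uphalf] and [half] are the ceiling and the floor of D / 2. *)
Definition anticodeD (n D : nat) : set 'rV[int]_n :=
  anticode n (uphalf D) D./2.

Arguments anticodeD : clear implicits.

Definition lattice_tiling (n : nat) (S L : set 'rV[int]_n) : Prop :=
  trivIset L (translate S) /\ \bigcup_(l in L) translate S l = setT.

Record measured_space (R : realType) := MeasuredSpace {
  ms_disp : measure_display;
  ms_type : measurableType ms_disp;
  ms_measure : {sigma_finite_measure set ms_type -> \bar R} }.

Definition point_space (R : realType) : measured_space R :=
  @MeasuredSpace R _ unit (dirac tt).

Definition line_space (R : realType) : measured_space R :=
  @MeasuredSpace R _ (measurableTypeR R) (@lebesgue_measure R).

(* [\x] under a name of its own: the library also declares a subprobability
   instance on [\x], which shadows its sigma-finite instance. *)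
Definition sf_product (R : realType) (X Y : measured_space R) :
    set (ms_type X * ms_type Y) -> \bar R :=
  (ms_measure X \x ms_measure Y)%E.

HB.instance Definition _ (R : realType) (X Y : measured_space R) :=
  Measure.copy (@sf_product R X Y) (ms_measure X \x ms_measure Y)%E.

Lemma sf_product_sigma_finite (R : realType) (X Y : measured_space R) :
  sigma_finite setT (@sf_product R X Y).
Proof.
have /sigma_finiteP[F [TF ndF Foo]] := sigma_finiteT (ms_measure X).
have /sigma_finiteP[G [TG ndG Goo]] := sigma_finiteT (ms_measure Y).
exists (fun n => F n `*` G n).
  rewrite -setXTT TF TG predeqE => -[x y]; split.
    move=> [/= [n _ Fnx] [k _ Gky]]; exists (maxn n k) => //; split.
    - by move: x Fnx; exact/subsetPset/ndF/leq_maxl.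
    - by move: y Gky; exact/subsetPset/ndG/leq_maxr.
  by move=> [n _ []/= ? ?]; split; exists n.
move=> k; have [? ?] := Foo k; have [? ?] := Goo k.
split; first exact: measurableX.
by rewrite /sf_product product_measure1E// lte_mul_pinfty// ge0_fin_numE.
Qed.

HB.instance Definition _ (R : realType) (X Y : measured_space R) :=
  Measure_isSigmaFinite.Build _ _ _ (@sf_product R X Y)
    (@sf_product_sigma_finite R X Y).

Definition prod_space (R : realType) (X Y : measured_space R) :
    measured_space R :=
  @MeasuredSpace R _ (ms_type X * ms_type Y)%type (@sf_product R X Y).

(* R * (R * (... * unit)) with the product of n copies of Lebesgue measure. *)
Fixpoint lebesgue_space (R : realType) (n : nat) : measured_space R :=
  if n is n'.+1 then prod_space (line_space R) (lebesgue_space R n')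
  else point_space R.

Fixpoint to_row (R : realType) (n : nat) :
    ms_type (lebesgue_space R n) -> 'rV[R]_n :=
  match n with
  | 0 => fun=> 0
  | n'.+1 => fun p => row_mx (p.1 : R)%:M (to_row p.2)
  end.

(* n-dimensional Lebesgue measure, transported along the bijection [to_row]. *)
Definition vol (R : realType) (n : nat) (A : set 'rV[R]_n) : \bar R :=
  ms_measure (lebesgue_space R n) (@to_row R n @^-1` A).

Definition conv_hull (R : realType) (n : nat) (A : set 'rV[R]_n) :
  set 'rV[R]_n := smallest (@convex_set R 'rV[R]_n) A.

Definition simplex (R : realType) (n : nat) : set 'rV[R]_n :=
  conv_hull (0 |` range (fun i : 'I_n => delta_mx 0 i)).

Arguments simplex : clear implicits.

Definition dilate (R : realType) (n : nat) (a : R) (K : set 'rV[R]_n) :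
  set 'rV[R]_n := [set a *: x | x in K].

Definition int_row (R : realType) (n : nat) (z : 'rV[int]_n) : 'rV[R]_n :=
  map_mx intr z.

(* For B in [unitmx] this is the full-rank lattice with basis the rows of B,
   and its determinant is `|\det B|. *)
Definition lattice_of (R : realType) (n : nat) (B : 'M[R]_n) : set 'rV[R]_n :=
  range (fun z : 'rV[int]_n => int_row R z *m B).

Definition lattice_packing (R : realType) (n : nat) (K Lam : set 'rV[R]_n) :
  Prop := trivIset Lam (fun l => interior (translate K l)).

Definition lattice_packing_density (R : realType) (n : nat)
    (K : set 'rV[R]_n) : \bar R :=
  ereal_sup [set (vol K * (`|\det B|^-1)%:E)%E | B in
    [set B : 'M[R]_n | B \in unitmx /\ lattice_packing K (lattice_of B)]].

(* Main.v *)
(* A point in the interior of l + c Delta_n has nonnegative coordinates relative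
   to l with sum < c, so a point common to the interiors of two translates gives
   an integer vector with positive and negative parts both of sum at most D, i.e.
   a lattice vector of length at most D.  In a tiling by S_{n,D} no such nonzero
   vector exists, since every vector of length at most D is a difference of two
   elements of S_{n,D}.  Scaling L by 1/(D+1) then packs Delta_n, whose volume is
   1/n!, and the tiling bounds the determinant of L by |S_{n,D}|. *)
Require Import Defs.
From mathcomp Require Import all_boot all_order all_algebra finmap.
From mathcomp Require Import all_classical all_reals all_analysis.
From mathcomp Require Import zify ring lra.
Import Order.TTheory GRing.Theory Num.Theory.
Import numFieldNormedType.Exports.
Local Open Scope classical_set_scope.
Local Open Scope ring_scope.
Set Implicit Arguments.
Unset Strict Implicit.
Unset Printing Implicit Defensive.

(** * Bases of integer lattices and their determinants *)

(** Cofactors along row [i] ignore the entries of that row, so they agree with those of [B]; this is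
    Cramer's rule. *)
Lemma det_replace_row (R : comNzRingType) (n : nat) (B : 'M[R]_n) (i : 'I_n)
    (v : 'rV[R]_n) :
  \det (\matrix_k (if k == i then v else row k B)) = (v *m \adj B) 0 i.
Proof.
rewrite (expand_det_row _ i) mxE; apply: eq_bigr => j _.
rewrite !mxE eqxx; congr (_ * _); rewrite /cofactor; congr (_ * \det _).
by apply/matrixP => k l; rewrite !mxE eq_sym (negbTE (neq_lift _ _)) !mxE.
Qed.

Section Sublattice.
Variables (n : nat) (L : set 'rV[int]_n).
Hypothesis L_closed : zmod_closed [in L].

Lemma lattice0 : L 0.
Proof. by have [+ _] := L_closed; rewrite inE. Qed.

Lemma latticeB x y : L x -> L y -> L (x - y).
Proof. by have [_ +] := L_closed => /(_ x y); rewrite !inE; apply. Qed.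

Lemma latticeN x : L x -> L (- x).
Proof. by move=> Lx; rewrite -sub0r; apply: latticeB => //; exact: lattice0. Qed.

Lemma latticeD x y : L x -> L y -> L (x + y).
Proof. by move=> Lx Ly; rewrite -[y]opprK; apply/latticeB/latticeN. Qed.

Lemma latticeMz x (k : int) : L x -> L (k *: x).
Proof.
move=> Lx; rewrite -[k]intz scaler_int.
have Lnat m : L (x *+ m).
  by elim: m => [|m IHm]; [exact: lattice0 | rewrite mulrS; exact: latticeD].
by case: k => m; [exact: Lnat | exact/latticeN/Lnat].
Qed.

Lemma lattice_mulmx (B : 'M[int]_n) (z : 'rV[int]_n) :
  (forall i, L (row i B)) -> L (z *m B).
Proof.
move=> LB; rewrite mulmx_sum_row.
elim/big_ind: _ => [|x y|i _]; [exact: lattice0 | exact: latticeD|].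
exact: latticeMz.
Qed.

(* Among the nonsingular matrices with rows in L, one of minimal |det| is a
   basis: reducing a row by division would otherwise lower |det|. *)
Lemma lattice_basis (B0 : 'M[int]_n) :
  \det B0 != 0 -> (forall i, L (row i B0)) ->
  exists B : 'M[int]_n,
    \det B != 0 /\ (forall x, L x <-> exists z, x = z *m B).
Proof.
move=> detB0 LB0.
pose P m := `[< exists B : 'M[int]_n,
  [/\ \det B != 0, forall i, L (row i B) & `|\det B|%N = m] >].
have exP : exists m, P m by exists `|\det B0|%N; apply/asboolP; exists B0.
case: (ex_minnP exP) => m /asboolP[B [detB LB <-]] minB.
exists B; split=> // x; split=> [Lx|[z ->]]; last exact: lattice_mulmx.
(* By Cramer's rule the coordinates of [x] in the rows of [B] are [e i / \det B]; it remains to see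
   that they are integers. *)
pose e i := (x *m \adj B) 0 i.
have dvd_e i : (\det B %| e i)%Z.
  pose q := (e i %/ \det B)%Z.
  pose C := \matrix_k (if k == i then x - q *: row i B else row k B).
  have detC : \det C = (e i %% \det B)%Z.
    rewrite det_replace_row mulmxBl mxE -/(e i) -scalemxAl -row_mul mul_mx_adj.
    by rewrite !mxE eqxx mulr1n [e i in LHS](divz_eq _ (\det B)) addrC addKr.
  have LC k : L (row k C).
    rewrite rowK; case: eqP => // _; apply: latticeB => //.
    exact: latticeMz.
  apply/dvdz_mod0P/eqP; apply: contraT => nz_mod.
  have : (`|\det B| <= `|\det C|)%N.
    by apply: minB; apply/asboolP; exists C; split=> //; rewrite detC.
  by rewrite detC leqNgt -ltz_nat !abszE (ger0_norm (modz_ge0 _ _)) ?ltz_mod.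
pose c : 'rV[int]_n := \row_i (e i %/ \det B)%Z.
exists c.
have eqdet : x *m \adj B = \det B *: c.
  by apply/rowP => i; rewrite [RHS]mxE [X in _ * X]mxE mulrC divzK.
have := congr1 (mulmx^~ B) eqdet.
rewrite -mulmxA mul_adj_mx mul_mx_scalar -scalemxAl.
move=> /rowP xE; apply/rowP => i; apply: (mulfI detB).
by have := xE i; rewrite [LHS]mxE [RHS]mxE.
Qed.

End Sublattice.

(* With B = U diag(d) V in Smith normal form, the |det B| points y V with
   0 <= y_i < |d_i| are pairwise incongruent modulo the rows of B. *)
Lemma det_le_card (n : nat) (B : 'M[int]_n) (S : {fset 'rV[int]_n}) :
    \det B != 0 ->
    (forall x, exists2 s, s \in S & exists z, x = s + z *m B) ->
  (`|\det B| <= #|` S|)%N.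
Proof.
move=> detB cov.
have [U uU [V uV [d _ defB]]] := int_Smith_normal_form B.
have diagE :
    \matrix_(i < n, j < n) (d`_i *+ (i == j :> nat)) = diag_mx (\row_i d`_i).
  by apply/matrixP => i j; rewrite !mxE.
rewrite diagE in defB.
have absU (M : 'M[int]_n) : M \in unitmx -> `|\det M|%N = 1%N.
  by rewrite unitmxE => /pred2P[] ->.
have detBE : `|\det B|%N = (\prod_(i < n) `|(d`_i)%R|)%N.
  rewrite defB !det_mulmx !abszM (absU _ uU) (absU _ uV) mul1n muln1 det_diag.
  rewrite (big_morph absz abszM (erefl _)).
  by apply: eq_bigr => i _; rewrite mxE.
pose T := {dffun forall i : 'I_n, 'I_(`|(d`_i)%R|)}.
have cardT : #|{: T}| = `|\det B|%N.
  rewrite card_dep_ffun foldrE big_map big_enum detBE.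
  by apply: eq_bigr => i _; rewrite card_ord.
pose y (f : T) : 'rV[int]_n := \row_i (f i)%:Z.
have /choice[s sP] (f : T) : exists s : S, exists z, y f *m V = val s + z *m B.
  by have [s sS xs] := cov (y f *m V); exists [` sS]%fset.
rewrite -cardT cardfE; apply: (@leq_card T S s) => f g sfg.
have [[z fz] [z' gz]] := (sP f, sP g).
(* A common representative puts [(y f - y g) *m V] in the row lattice of [B]; cancelling [V] makes
   coordinate [i] divisible by [d_i]. *)
have : y f - y g = (z - z') *m U *m diag_mx (\row_i d`_i).
  apply: (can_inj (mulmxK uV)).
  rewrite mulmxBl fz gz sfg opprD addrACA subrr add0r.
  by rewrite -mulmxBl defB !mulmxA.
move=> /rowP yfg; apply/ffunP => i; apply: val_inj => /=.
have := yfg i; rewrite mul_mx_diag ![in LHS]mxE [RHS]mxE [X in _ * X]mxE => fgi.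
have /eqP : ((f i)%:Z = (g i)%:Z %[mod (d`_i)%R])%Z.
  by apply/eqP; rewrite eqz_mod_dvd fgi dvdz_mull.
rewrite -![(_ %% (d`_i)%R)%Z]modz_abs !modz_small ?ltz_nat ?ltn_ord//=.
by move=> /eqP[].
Qed.

(** * Anticodes and their differences *)

Lemma sum_pos_part_le (n : nat) (x : 'I_n -> int) (b : 'I_n -> nat) (N : nat) :
    (forall i, x i <= (b i)%:Z) -> (\sum_i b i <= N)%N ->
  \sum_i pos_part (x i) <= N%:Z.
Proof.
move=> xb bN; apply: (@le_trans _ _ (\sum_i (b i)%:Z)).
  by apply: ler_sum => i _; rewrite ge_max xb.
by rewrite -(big_morph Posz PoszD (erefl _)) lez_nat.
Qed.

(** Induction on [P]: one unit of a nonzero entry of [a] goes to [b]; at [P = 0] all that is left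
    goes to [c]. *)
Lemma split_sum (n : nat) (a : 'I_n -> nat) (P Q : nat) :
    (\sum_i a i <= P + Q)%N ->
  exists b c : 'I_n -> nat,
    [/\ a =1 (fun i => b i + c i)%N, (\sum_i b i <= P)%N & (\sum_i c i <= Q)%N].
Proof.
elim: P a => [|P IHP] a aPQ.
  by exists (fun=> 0%N), a; split=> //; rewrite big1.
have [i /= ai|a0] := pickP (fun i => a i != 0%N); last first.
  exists (fun=> 0%N), (fun=> 0%N).
  by split=> [i||]; [rewrite (eqP (negbFE (a0 i)))| |];
    rewrite ?big1.
have [|b [c [abc bP cQ]]] := IHP (fun j => a j - (j == i))%N.
  rewrite -ltnS (leq_trans _ aPQ)// (bigD1 i)//= [ltnRHS](bigD1 i)//= eqxx.
  rewrite subn1 -addSn prednK ?lt0n// leq_add2l leq_sum// => j _.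
  exact: leq_subr.
exists (fun j => b j + (j == i))%N, c; split=> //.
  move=> j; rewrite addnAC -abc; case: eqP => [->|_]; last first.
    by rewrite subn0 addn0.
  by rewrite subn1 addn1 prednK// lt0n.
rewrite big_split/= -addn1 leq_add// (bigD1 i)//= eqxx big1//.
by move=> j /negbTE ->.
Qed.

(* Splitting l^+ = b + c and l^- = b' + c' with |b|, |c'| <= P and
   |c|, |b'| <= Q, take u = b - b', so that u - l = c' - c. *)
Lemma anticode_difference (n P Q : nat) (l : 'rV[int]_n) :
    da 0 l <= (P + Q)%:Z ->
  exists2 u, anticode n P Q u & anticode n P Q (u - l).
Proof.
rewrite /da ge_max => /andP[ln lp].
have natE (x : int) : (`|pos_part x|%N)%:Z = pos_part x.
  by rewrite gez0_abs// le_max lexx orbT.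
have [|b [c [bc bP cQ]]] :=
  @split_sum n (fun i => `|(pos_part (l 0 i))%R|%N) P Q.
  rewrite -lez_nat (big_morph Posz PoszD (erefl _)) (le_trans _ lp)//.
  by apply: ler_sum => i _; rewrite natE mxE subr0.
have [|b' [c' [bc' bP' cQ']]] :=
  @split_sum n (fun i => `|(pos_part (- l 0 i))%R|%N) Q P.
  rewrite addnC -lez_nat (big_morph Posz PoszD (erefl _)) (le_trans _ ln)//.
  by apply: ler_sum => i _; rewrite natE mxE sub0r.
have lE i : l 0 i = (b i)%:Z + (c i)%:Z - ((b' i)%:Z + (c' i)%:Z).
  by rewrite -!PoszD -bc -bc' !natE /pos_part; lia.
exists (\row_i ((b i)%:Z - (b' i)%:Z)).
  split; [apply: sum_pos_part_le bP|apply: sum_pos_part_le bP'] => i.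
    by rewrite mxE gerBl.
  by rewrite mxE opprB gerBl.
split; [apply: sum_pos_part_le cQ'|apply: sum_pos_part_le cQ] => i;
  rewrite !mxE lE; lia.
Qed.

Lemma tiling_da_gt (n D : nat) (L : set 'rV[int]_n) (l : 'rV[int]_n) :
    lattice_tiling (anticodeD n D) L -> L 0 -> L l -> l != 0 ->
  D%:Z < da 0 l.
Proof.
move=> [tL _] L0 Ll; rewrite ltNge; apply: contra => lD.
have [|u Su Sul] := @anticode_difference n (uphalf D) D./2 l.
  by rewrite uphalf_half -addnA addnn odd_double_half.
(* The point [u] lies in S + 0 and, as [(u - l) + l], in S + l. *)
rewrite eq_sym; apply/eqP/tL => //; exists u; split.
  by exists u; rewrite ?addr0.
by exists (u - l); rewrite ?subrK.
Qed.

(** Coordinates lie between -Q and P, so shifting by Q reaches a finite function type. Finiteness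
    makes the cardinality of [fset_set] meaningful. *)
Lemma finite_anticode (n P Q : nat) : finite_set (anticode n P Q).
Proof.
pose g (f : {ffun 'I_n -> 'I_(P + Q).+1}) : 'rV[int]_n :=
  \row_i ((f i)%:Z - Q%:Z).
apply: (@sub_finite_set _ _ (range g)); last first.
  exact/finite_image/finite_finset.
move=> x [xP xQ].
have pos_ge0 (y : int) : 0 <= pos_part y by rewrite le_max lexx orbT.
have le_pos (y : 'I_n -> int) i N : \sum_i pos_part (y i) <= N -> y i <= N.
  move=> yN; apply: le_trans yN; rewrite (bigD1 i)//=.
  rewrite (@le_trans _ _ (pos_part (y i)))//.
    by rewrite le_max lexx.
  by rewrite lerDl sumr_ge0.
have xiP i := @le_pos _ i _ xP.
have xiQ i := @le_pos _ i _ xQ.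
exists [ffun i => inord `|(x 0 i + Q%:Z)%R|%N] => //.
apply/rowP => i; rewrite mxE ffunE inordK; have := xiP i; have := xiQ i; lia.
Qed.

(** * The simplex by inequalities, and its packings *)

(** The size [a] is a parameter because the slices of a simplex are simplices of smaller size. *)
Definition corner (R : realType) (n : nat) (a : R) : set 'rV[R]_n :=
  [set x | (forall i, 0 <= x 0 i) /\ \sum_i x 0 i <= a].

Arguments corner {R} n a.

Section Simplex.
Variables (R : realType) (n : nat).
Implicit Types (x y l : 'rV[R]_n) (c : R).

Lemma convex_combination (C : set 'rV[R]_n) x y (t : R) :
    @convex_set R 'rV[R]_n C -> 0 <= t <= 1 -> C x -> C y ->
  C (t *: x + (1 - t) *: y).
Proof.
move=> convC /andP[t0 t1] Cx Cy.
have := convC x y (Itv01 t0 t1).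
by rewrite !inE; apply.
Qed.

(** The point 0 of [C] absorbs the missing weight. Induction on [s] splits off the first weight and
    divides the others by [1 - w i]. *)
Lemma sub_convex_combination (C : set 'rV[R]_n) (e : 'I_n -> 'rV[R]_n)
    (s : seq 'I_n) (w : 'I_n -> R) :
    @convex_set R 'rV[R]_n C -> C 0 -> (forall i, C (e i)) ->
    (forall i, 0 <= w i) -> \sum_(i <- s) w i <= 1 ->
  C (\sum_(i <- s) w i *: e i).
Proof.
move=> convC C0 Ce; elim: s w => [|i s IHs] w w0; first by rewrite !big_nil.
rewrite !big_cons => ws.
have sum_ge0 : 0 <= \sum_(j <- s) w j by exact: sumr_ge0.
have wi1 : w i <= 1 by apply: le_trans ws; rewrite lerDl.
(* Rescaling fails when [w i = 1], but then all other weights vanish. *)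
have [wiE|wi_neq1] := eqVneq (w i) 1.
  have : \sum_(j <- s) w j == 0.
    by rewrite eq_le sum_ge0 andbT; move: ws; rewrite wiE gerDl.
  rewrite psumr_eq0 => [/allP w_eq0|//].
  rewrite wiE scale1r big_seq big1 ?addr0// => j js.
  by have /eqP -> := w_eq0 j js; rewrite scale0r.
have t0 : 0 < 1 - w i by rewrite subr_gt0 lt_neqAle wi_neq1.
have -> : \sum_(j <- s) w j *: e j =
    (1 - w i) *: \sum_(j <- s) (w j / (1 - w i)) *: e j.
  rewrite scaler_sumr; apply: eq_bigr => j _.
  by rewrite scalerA mulrCA divff ?mulr1// gt_eqF.
apply: convex_combination => //; first by rewrite w0.
apply: IHs => [j|]; first by rewrite divr_ge0// ltW.
by rewrite -mulr_suml ler_pdivrMr// mul1r lerBrDl.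
Qed.

Lemma simplexE : simplex R n = corner n 1.
Proof.
apply/seteqP; split=> x.
  move/(_ (corner n 1)); apply.
  split=> [y z t|y [->|[i _ <-]]].
  - rewrite !inE => -[y0 y1] [z0 z1].
    have t0 : 0 <= t%:num by [].
    have t1 : 0 <= 1 - t%:num by rewrite subr_ge0.
    split=> [i|]; first by rewrite !mxE addr_ge0// mulr_ge0.
    have -> : \sum_i (conv t y z : 'rV[R]_n) 0 i =
        t%:num * (\sum_i y 0 i) + (1 - t%:num) * (\sum_i z 0 i).
      by rewrite !mulr_sumr -big_split/=; apply: eq_bigr => i _; rewrite !mxE.
    nra.
  - by split=> [i|]; rewrite ?big1// => *; rewrite mxE.
  - split=> [j|]; first by rewrite mxE ler0n.
    rewrite (bigD1 i)//= big1 ?mxE ?eqxx ?addr0// => j ji.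
    by rewrite mxE (negbTE ji) andbF.
move=> [x0 x1] C [convC subC].
rewrite [x]row_sum_delta.
apply: sub_convex_combination => // [|i]; apply: subC; first by left.
by right; exists i.
Qed.

Lemma dilate_simplexP c x : 0 < c ->
  dilate c (simplex R n) x <-> corner n c x.
Proof.
move=> c0; rewrite simplexE; split=> [[y [y0 y1] <-]|[x0 xc]].
  split=> [i|]; first by rewrite mxE mulr_ge0// ltW.
  under eq_bigr do rewrite mxE.
  by rewrite -mulr_sumr ler_piMr// ltW.
exists (c^-1 *: x); last by rewrite scalerA divff ?scale1r// gt_eqF.
split=> [i|]; first by rewrite mxE mulr_ge0// invr_ge0 ltW.
under eq_bigr do rewrite mxE.
by rewrite -mulr_sumr mulrC ler_pdivrMr// mul1r.
Qed.

Lemma interior_dilate_simplex c l x : (0 < n)%N -> 0 < c ->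
    interior (translate (dilate c (simplex R n)) l) x ->
  (forall i, 0 <= x 0 i - l 0 i) /\ \sum_i (x 0 i - l 0 i) < c.
Proof.
move=> n_gt0 c0 intx.
have memP y : translate (dilate c (simplex R n)) l y ->
    (forall i, 0 <= y 0 i - l 0 i) /\ \sum_i (y 0 i - l 0 i) <= c.
  move=> [z /(dilate_simplexP _ c0)[z0 zc] <-]; split=> [i|].
    by rewrite mxE addrK.
  by under eq_bigr do rewrite mxE addrK.
have [x0 _] := memP _ (interior_subset intx); split=> //.
move: intx => /nbhs_ballP[e /= e0 xe].
(* Moving [x] by e/2 along the diagonal stays in the ball and, as [n > 0], strictly raises the
   coordinate sum, which is still at most [c]. *)
pose v : 'rV[R]_n := const_mx (e / 2).
have /xe/memP[_] : ball x e (x + v).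
  split=> // i j; rewrite !mxE /ball/= opprD addNKr normrN.
  rewrite gtr0_norm ?divr_gt0//.
  by rewrite ltr_pdivrMr// ltr_pMr// ltr1n.
apply: lt_le_trans; rewrite -subr_gt0 -sumrB.
rewrite (eq_bigr (fun=> e / 2)) => [|i _]; last by rewrite !mxE; ring.
by rewrite sumr_const card_ord pmulrn_lgt0// divr_gt0.
Qed.

(** For [x] interior to both translates, [x - l'] dominates the positive part of [l - l']
    coordinatewise and [x - l] that of [l' - l]; both have coordinate sum below [c]. *)
Lemma simplex_packing c (Lam : set 'rV[R]_n) :
    (0 < n)%N -> 0 < c ->
    (forall l l', Lam l -> Lam l' -> l != l' ->
      c <= Num.max (\sum_i Num.max (l 0 i - l' 0 i) 0)
                   (\sum_i Num.max (l' 0 i - l 0 i) 0)) ->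
  lattice_packing (dilate c (simplex R n)) Lam.
Proof.
move=> n_gt0 c0 sep l l' Laml Laml' [x []].
move=> /(interior_dilate_simplex n_gt0 c0)[xl0 xlc].
move=> /(interior_dilate_simplex n_gt0 c0)[xl'0 xl'c].
apply/eqP; apply: contraT => /(sep _ _ Laml Laml').
rewrite leNgt gt_max; apply: contraNT => _; apply/andP; split.
  apply: le_lt_trans xl'c; apply: ler_sum => i _.
  by have := xl0 i; have := xl'0 i; rewrite ge_max; lra.
apply: le_lt_trans xlc; apply: ler_sum => i _.
by have := xl0 i; have := xl'0 i; rewrite ge_max; lra.
Qed.

End Simplex.

(** * The volume of the simplex *)

(** This integrates the slice volumes. The case [a = 0] is separate because the fundamental theorem
    of calculus is applied on a nondegenerate interval. *)
Lemma integral_truncated_power (R : realType) (n : nat) (a : R) : 0 <= a ->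
  (\int[lebesgue_measure]_(x in `[0%R, a]) ((a - x) ^+ n / n`!%:R)%:E =
    (a ^+ n.+1 / n.+1`!%:R)%:E)%E.
Proof.
rewrite le_eqVlt => /predU1P[<-|a0].
  by rewrite set_itv1 integral_set1 expr0n mul0r.
pose F (x : R) := - ((a - x) ^+ n.+1 / n.+1`!%:R).
have dF (x : R) : is_derive x 1 F ((a - x) ^+ n / n`!%:R).
  have dX : is_derive x 1 ((cst a - id : R -> R) ^+ n.+1)
      (- (n.+1%:R * (a - x) ^+ n)).
    by apply: is_derive_eq; rewrite sub0r /GRing.scale/= mulrN1.
  have -> : F = - (n.+1`!%:R)^-1 *: ((cst a - id : R -> R) ^+ n.+1).
    by apply/funext => y; rewrite /F fctE [RHS]mulNr mulrC.
  apply: is_derive_eq; rewrite scalerN scaleNr opprK /GRing.scale/=.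
  by rewrite factS natrM; field; rewrite nat1r !pnatr_eq0 -lt0n fact_gt0 /=.
have cF : continuous F.
  move=> x; apply/differentiable_continuous/derivable1_diffP.
  by have [] := dF x.
have cf : continuous (fun x : R => (a - x) ^+ n / n`!%:R).
  move=> x; apply: cvgM; last exact: cvg_cst.
  apply: (@continuous_comp _ _ _ (fun y => a - y) (fun y => y ^+ n));
    last exact: exprn_continuous.
  by apply: cvgB; [exact: cvg_cst|exact: cvg_id].
rewrite (@continuous_FTC2 _ _ F 0 a a0).
- by rewrite /F subrr subr0 expr0n mul0r oppr0 EFinN sub0e oppeK.
- by apply: continuous_subspaceT.
- split.
  + by move=> x _; have [] := dF x.
  + exact/cvg_at_right_filter/cF.
  + exact/cvg_at_left_filter/cF.
- by move=> x _; rewrite derive1E; exact: derive_val.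
Qed.

Lemma corner_to_row (R : realType) (n : nat) (a x : R)
    (y : ms_type (lebesgue_space R n)) :
  corner n.+1 a (@to_row R n.+1 (x, y)) <->
    0 <= x /\ corner n (a - x) (to_row y).
Proof.
rewrite /corner /=.
have row0 : row_mx x%:M (to_row y) 0 (lshift n 0) = x.
  by rewrite row_mxEl mxE eqxx.
have rowS i : row_mx x%:M (to_row y) 0 (rshift 1 i) = to_row y 0 i.
  by rewrite row_mxEr.
rewrite (@big_split_ord _ _ _ 1 n) /= big_ord1 row0.
under eq_bigr do rewrite rowS.
rewrite -lerBrDl; split=> [[pos le_a]|[x0 [pos le_a]]].
  by split; [rewrite -row0 | split=> // i; rewrite -rowS].
split=> // i; rewrite -[i](@splitK 1 n); case: (fintype.split _) => j /=.
  by rewrite [j]ord1 row0.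
by rewrite rowS.
Qed.

(** Induction on the dimension: the product measure integrates the measures of the sections, and the
    section at [x] is the corner of size [a - x] if [0 <= x <= a], else empty. *)
Lemma vol_corner (R : realType) (n : nat) (a : R) : 0 <= a ->
  vol (corner n a) = (a ^+ n / n`!%:R)%:E.
Proof.
elim: n a => [|n IHn] a a0.
  rewrite /vol /= /dirac /= indicE mem_set ?expr0 ?divr1//.
  by split=> [[]//|]; rewrite big_ord0.
rewrite -integral_truncated_power// [RHS]integral_mkcond.
apply: eq_integral => x _ /=.
rewrite patchE mem_setE in_itv/=.
have -> : xsection (@to_row R n.+1 @^-1` corner n.+1 a) x =
    if 0 <= x <= a then @to_row R n @^-1` corner n (a - x) else set0.
  apply/seteqP; split=> y; rewrite xsectionE /=.
    move=> /corner_to_row[x0 y_in].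
    have -> : 0 <= x <= a; last by [].
    by case: y_in => y0 ya; rewrite x0 -subr_ge0 (le_trans _ ya)// sumr_ge0.
  by case: ifP => // /andP[x0 _] y_in; apply/corner_to_row.
case: ifP => [/andP[x0 xa]|_]; last exact: measure0.
by rewrite -/(vol _) IHn// subr_ge0.
Qed.

(** * From the asymmetric metric to packings and density *)

Lemma intr_da (R : realType) (n : nat) (x y : 'rV[int]_n) :
  (da x y)%:~R =
    Num.max (\sum_i Num.max (int_row R x 0 i - int_row R y 0 i) 0)
            (\sum_i Num.max (int_row R y 0 i - int_row R x 0 i) 0).
Proof.
rewrite /da.
have intr_max (a b : int) : (Num.max a b)%:~R = Num.max a%:~R b%:~R :> R.
  case: (leP a b) => ab; first by rewrite max_r// ler_int.
  by rewrite max_l// ler_int ltW.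
rewrite intr_max !rmorph_sum /=; congr Num.max; apply: eq_bigr => i _;
  by rewrite /pos_part intr_max !mxE rmorphB.
Qed.

(** The scale [k] serves both claims: 1 for the packing by L itself, 1/(D+1) for the density
    bound. *)
Lemma lattice_simplex_packing (R : realType) (n D : nat) (k : R)
    (L : set 'rV[int]_n) :
    (0 < n)%N -> 0 < k -> zmod_closed [in L] ->
    (forall l, L l -> l != 0 -> D%:Z < da 0 l) ->
  lattice_packing (dilate (k * D.+1%:R) (simplex R n))
    [set k *: int_row R l | l in L].
Proof.
move=> n_gt0 k_gt0 L_closed sep; apply: simplex_packing => //.
  by rewrite mulr_gt0.
move=> _ _ [l Ll <-] [l' Ll' <-] ll'.
have {}ll' : l' - l != 0.
  by rewrite subr_eq0; apply: contra ll' => /eqP ->.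
have scale_sum (x y : 'rV[R]_n) :
    \sum_i Num.max ((k *: x) 0 i - (k *: y) 0 i) 0 =
    k * \sum_i Num.max (x 0 i - y 0 i) 0.
  rewrite mulr_sumr; apply: eq_bigr => i _.
  by rewrite !mxE -mulrBr maxr_pMr ?ltW// mulr0.
rewrite !scale_sum -maxr_pMr ?(ltW k_gt0)// ler_pM2l// -intr_da.
have -> : da l l' = da 0 (l' - l).
  by rewrite /da; congr Num.max; apply: eq_bigr => i _;
    rewrite !mxE ?sub0r ?subr0 ?opprB.
(* Integrality turns D < da into D + 1 <= da, which gives the dilation factor. *)
rewrite -[D.+1%:R]/(D.+1%:Z%:~R) ler_int.
exact/sep/ll'/(latticeB L_closed).
Qed.

Lemma da_lattice_le (n D : nat) (L : set 'rV[int]_n) (l : 'rV[int]_n) :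
  D%:Z < da_lattice L -> L l -> l != 0 -> D%:Z < da 0 l.
Proof.
(* Without a minimum [da_lattice] is the default 0, which cannot exceed [D]. *)
rewrite /da_lattice; case: xgetP => [m _ [_ lb_m] Dm Ll l0|_]; last first.
  by rewrite ltNge.
by apply: lt_le_trans Dm _; apply: lb_m; exists l => //; split=> //; exact/eqP.
Qed.

Lemma full_rank_basis (n : nat) (L : set 'rV[int]_n) : full_rank_sublattice L ->
  exists B : 'M[int]_n, \det B != 0 /\ (forall x, L x <-> exists z, x = z *m B).
Proof.
move=> [L_closed [B0 freeB0 LB0]]; apply: (lattice_basis L_closed _ LB0).
by move: freeB0; rewrite row_free_unit unitmxE det_map_mx unitfE intr_eq0.
Qed.

Theorem theorem5p3 (R : realType) (n : nat) (n_ge1 : (1 <= n)%N) (D : nat) :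
  (forall L : set 'rV[int]_n,
      full_rank_sublattice L -> D%:Z < da_lattice L ->
      lattice_packing (dilate D.+1%:R (simplex R n)) (@int_row R n @` L)) /\
  (forall L : set 'rV[int]_n,
      full_rank_sublattice L -> lattice_tiling (anticodeD n D) L ->
      ((D.+1%:R ^+ n / (n`!%:R * #|` fset_set (anticodeD n D)|%:R))%:E
        <= lattice_packing_density (simplex R n))%E).
Proof.
split=> L L_full.
  have [L_closed _] := L_full => D_lt.
  have := @lattice_simplex_packing R n D 1 L n_ge1 ltr01 L_closed
    (fun l => da_lattice_le D_lt).
  rewrite mul1r (_ : (fun l => 1 *: int_row R l) = @int_row R n)//.
  by apply/funext => l; rewrite scale1r.
have [L_closed _] := L_full => tiling.
have L0 := lattice0 L_closed.
have [B [detB LB]] := full_rank_basis L_full.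
have D_gt0 : 0 < D.+1%:R :> R by [].
pose k : R := D.+1%:R^-1.
have k_gt0 : 0 < k by rewrite invr_gt0.
pose B' : 'M[R]_n := k *: map_mx intr B.
have detB' : \det B' = k ^+ n * (\det B)%:~R by rewrite detZ det_map_mx.
have pack := @lattice_simplex_packing R n D k L n_ge1 k_gt0 L_closed
  (fun l Ll => tiling_da_gt tiling L0 Ll).
have dilate1 : dilate (k * D.+1%:R) (simplex R n) = simplex R n.
  rewrite mulVf ?gt_eqF//; apply/seteqP; split=> [_ [x xS <-]|x xS].
    by rewrite scale1r.
  by exists x; rewrite ?scale1r.
have latB' : lattice_of B' = [set k *: int_row R l | l in L].
  have rowE z : int_row R z *m B' = k *: int_row R (z *m B).
    by rewrite -scalemxAr /int_row map_mxM.
  apply/seteqP; split=> [_ [z _ <-]|_ [l /LB[z ->] <-]].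
    by exists (z *m B) => //; apply/LB; exists z.
  by exists z.
(* The lattice of [B'] is L scaled by [k], so its packing density is a lower bound for the
   supremum. *)
apply: (@le_trans _ _ (vol (simplex R n) * (`|\det B'|^-1)%:E)%E); last first.
  apply: ereal_sup_ubound; exists B' => //.
  split; last by rewrite latB' -[simplex R n]dilate1.
  by rewrite unitmxE unitfE detB' mulf_neq0 ?intr_eq0// expf_neq0 ?gt_eqF.
rewrite simplexE vol_corner// expr1n -EFinM lee_fin.
set m := #|` _|.
(* The tiling covers, so the anticode meets every coset of L. *)
have detB_le : (`|\det B| <= m)%N.
  apply: det_le_card => // x.
  have [_ /(congr1 (fun X => X x))] := tiling.
  rewrite propeqE => -[_ /(_ I)[l Ll [s sS <-]]].
  exists s; last by have /LB[z ->] := Ll; exists z.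
  by rewrite in_fset_set ?inE//; exact: finite_anticode.
have detB_gt0 : (0 < `|\det B|)%N by rewrite absz_gt0.
(* As 1/|det B'| = (D+1)^n / |det B|, the inequality reduces to |det B| <= m. *)
rewrite detB' normrM normrX gtr0_norm// -intr_norm -abszE exprVn !invfM invrK.
rewrite mulrCA div1r ler_wpM2l ?exprn_ge0// ler_wpM2l ?invr_ge0 ?ler0n//.
by rewrite lef_pV2 ?posrE ?ler_nat ?ltr0n// (leq_trans detB_gt0).
Qed.
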